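(* If $D=8$, then $R_{k,3,2}$, $R_{k,3,4}$ and $R_{k,3,8}$ are irreducible over $\mathbb{Q}$ for all $k\geq 2$.
   Context: Let $D\geq 2$ be an integer and, for $a\in\mathbb{C}$, let $f_a(z)=az^D+1$, with critical point $0$. A point $z$ is periodic for $f_a$ with period $n\geq 1$ if $f_a^{\circ n}(z)=z$ and $n$ is the least such integer; it is preperiodic with preperiod $k\geq 0$ and period $n$ if $k$ is the least nonnegative integer such that $f_a^{\circ k}(z)$ is periodic, and $f_a^{\circ k}(z)$ has period $n$. For $n\geq 1$, $P_n\in\mathbb{Z}[a]$ is defined by $P_n(a)=f_a^{\circ n}(0)$, i.e. $P_1=1$ and $P_{n+1}=aP_n^D+1$. For $k\geq 2$, $n\geq 1$ and $d\geq 2$ dividing $D$, $R_{k,n,d}$ is the monic polynomial with simple roots whose roots are the parameters $a\in\mathbb{C}$ such that $0$ is preperiodic for $f_a$ with preperiod $k$ and period $n$, and $f_a^{\circ(k+n-1)}(0)=\omega f_a^{\circ(k-1)}(0)$ for some primitive $d$-th root of unity $\omega$. It belongs to $\mathbb{Z}[a]$; equivalently, $R_{k,n,d}=\prod_{m\mid n}\left(P_{k,m,d}/P_{\gcd(m,k-1)}^{\varphi(d)}\right)^{\mu(n/m)}$, where $P_{k,m,d}:=\prod_{\omega}(P_{k+m-1}-\omega P_{k-1})$ (product over primitive $d$-th roots of unity), $\mu$ is the Möbius function and $\varphi$ is the Euler totient function. *)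

(* Defs.v *)
From mathcomp Require Import all_boot all_order all_algebra.
From mathcomp Require Import classical_sets fsbigop reals complex.

Set Implicit Arguments.
Unset Strict Implicit.
Unset Printing Implicit Defensive.

Import GRing.Theory.

Local Open Scope ring_scope.

Section Dynamics.
Variables (T : Type) (g : T -> T).

Definition has_period (z : T) (n : nat) : Prop :=
  [/\ (0 < n)%N, iter n g z = z &
      forall m : nat, (0 < m < n)%N -> iter m g z <> z].

Definition periodic (z : T) : Prop := exists n : nat, has_period z n.

Definition preperiodic (z : T) (k n : nat) : Prop :=
  has_period (iter k g z) n /\
  forall j : nat, (j < k)%N -> ~ periodic (iter j g z).

End Dynamics.

Definition unicritical (C : pzSemiRingType) (D : nat) (a z : C) : C :=
  a * z ^+ D + 1.

(* Intended for k >= 1, where the truncated subtractions are exact. *)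
Definition misiurewicz (C : nzRingType) (D k n d : nat) : set C :=
  [set a : C | preperiodic (unicritical D a) 0 k n /\
     exists2 w : C, d.-primitive_root w &
       iter (k + n - 1) (unicritical D a) 0 =
       w * iter (k - 1) (unicritical D a) 0]%classic.

(* The product over a set is 1 by convention when the set is infinite; the
   set of parameters below is finite (its elements are roots of a nonzero
   polynomial), so this is the monic polynomial with simple roots exactly at
   these parameters. *)
Definition misiurewicz_poly (R : realType) (D k n d : nat) : {poly R[i]} :=
  \big[*%R/1]_(a \in misiurewicz D k n d) ('X - a%:P).

(* For P with complex coefficients: P lies in Q[X] and is irreducible there. *)
Definition irreducible_over_rat (C : unitRingType) (P : {poly C}) : Prop :=
  exists2 p : {poly rat}, P = map_poly ratr p & irreducible_poly p.

(* Main.v *)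
Require Import Defs.
From mathcomp Require Import all_boot all_order all_algebra all_field.
From mathcomp Require Import boolp classical_sets fsbigop reals complex.
From mathcomp Require Import polyorder ring zify.

(** Write D = 2^s and e = 2^j with j < s, let P_m be the m-th point of the
    critical orbit as a polynomial in the parameter, let n be prime, and put
    l = k - 1 >= 1. A primitive (2 e)-th root of unity is a root of X^e + 1, so
    the product of the P_{l+n} - w P_l over all such roots w is the integer
    polynomial F = P_{l+n}^e + P_l^e, and the corresponding product for period 1
    is A = P_{l+1}^e + P_l^e. The polynomial A P_n^c divides F, where c = e if n
    divides l and c = 0 otherwise; let F = f A P_n^c.

    Irreducibility of f comes from a generalized Eisenstein criterion
    (schonemann_criterion): a monic f in Z[X] that is a power of phi mod p, with
    phi irreducible mod p, is irreducible as soon as f is not in the ideal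
    (phi, p^2). Here p = 2 and phi = P_n.

    - Modulo 2, z |-> a z^D + 1 carries differences to D-th powers of
      differences, whence P_{l+n} + P_l = X^M P_n^(D^l) with M independent of n
      (crit_orbit_pchar2). Dividing F = X^(M e) P_n^(e D^l) by A = X^(M e) shows
      that f is a power of P_n mod 2.
    - Modulo P_n the critical orbit is n-periodic, which gives f A = 2 u with u
      prime to P_n mod 2 (misiurewicz_factor). If n does not divide l, then
      u = P_l^e. If n divides l, both P_l and P_{l+n} are P_n times a polynomial
      congruent to 1 modulo P_n, and u = 1. If f were in (P_n, 4), then 2 u
      would be too, and P_n would divide u mod 2.

    For D = 8 and n = 3 the reduction of P_3 is X^9 + X + 1, which is
    irreducible over F_2 (crit_poly_8_3_irreducible).

    It remains to see that f is the monic polynomial with simple roots at the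
    Misiurewicz parameters. Its roots are simple because f is irreducible, and
    the parameters are the zeros of F that are neither zeros of A (where the
    orbit falls on a fixed point) nor of P_n (where 0 is periodic)
    (misiurewiczP). By irreducibility f could share a zero with A or P_n only by
    dividing it, which is impossible modulo 2, respectively by degree. *)

Set Implicit Arguments.
Unset Strict Implicit.
Unset Printing Implicit Defensive.

Import GRing.Theory.

Local Open Scope ring_scope.

(** * Integer polynomials modulo a prime *)

Notation reduction p := (map_poly (intr : int -> 'F_p)).

Lemma reduction_eq0P (p : nat) (f : {poly int}) :
  prime p -> reduction p f = 0 -> exists g, f = g *+ p.
Proof.
move=> p_pr f0; exists (map_poly (fun c => (c %/ p)%Z) f).
apply/polyP => i; rewrite coefMn coef_map_id0 ?div0z //.
have /eqP := congr1 (fun g : {poly 'F_p} => g`_i) f0.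
rewrite coef_map coef0 /= -(dvdz_pcharf (pchar_Fp p_pr)) => /divzK {1}<-.
by rewrite -mulr_natr natz.
Qed.

Lemma dvdp_reductionP (p : nat) (phi f : {poly int}) :
    prime p -> reduction p phi %| reduction p f ->
  exists q r, f = phi * q + r *+ p.
Proof.
move=> p_pr /Pdiv.Field.dvdpP [w fw].
pose q := map_poly (fun x : 'F_p => (x : nat)%:Z) w.
have qw : reduction p q = w.
  apply/polyP => i; rewrite coef_map coef_map_id0 //=.
  by rewrite -[RHS]natr_Zp.
have [|r fr] := @reduction_eq0P p (f - phi * q) p_pr.
  by rewrite rmorphB rmorphM /= qw fw mulrC subrr.
by exists q, r; rewrite -fr addrC subrK.
Qed.

Lemma irreducible_dvd_of_dvd_exp (F : fieldType) (phi u : {poly F}) N :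
  irreducible_poly phi -> u %| phi ^+ N -> size u != 1%N -> phi %| u.
Proof.
move=> irr u_dvd; apply: contraNT => ndvd.
have cop : coprimep u (phi ^+ N).
  by rewrite coprimep_expr // coprimep_sym irreducible_poly_coprime.
by rewrite -dvdp1 -(Gauss_dvdpr _ cop) mulr1.
Qed.

Lemma size_reduction_monic (p : nat) (f : {poly int}) :
  f \is monic -> size (reduction p f) = size f.
Proof.
by move=> f_mon; rewrite size_map_poly_id0 ?(monicP f_mon) ?rmorph1 ?oner_eq0.
Qed.

(** If f = u v with u and v nonconstant, both reductions are nonconstant divisors
    of a power of the irreducible reduction of phi, hence multiples of it. So u
    and v lie in the ideal (phi, p), and their product in (phi, p^2). *)
Lemma schonemann_criterion (p N : nat) (f phi : {poly int}) :
    prime p -> f \is monic -> irreducible_poly (reduction p phi) ->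
    (0 < N)%N -> reduction p f = reduction p phi ^+ N ->
    (forall q r : {poly int}, f <> phi * q + r *+ (p ^ 2)) ->
  irreducible_poly f.
Proof.
move=> p_pr f_mon irr N_gt0 fN fnot; split.
  rewrite -(size_reduction_monic p f_mon) fN.
  have [phi_gt1 _] := irr; rewrite -subn_gt0 subn1 size_exp muln_gt0 N_gt0.
  by rewrite andbT -subn1 subn_gt0.
move=> q q1; rewrite -dvdp_rat_int => /dvdpP_rat_int [u [a a0 qa] [v fuv]].
have qu : q %= u by rewrite /eqp -!dvdp_rat_int qa dvdpZl // dvdpZr // dvdpp.
have u1 : size u != 1%N by rewrite -(eqp_size qu).
apply: (eqp_trans qu); have f0 := monic_neq0 f_mon.
have [v1|v1] := eqVneq (size v) 1%N.
  have /size_poly1P [c c0 vc] : size v == 1%N by apply/eqP.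
  by rewrite eqp_sym fuv vc mulrC mul_polyC eqp_scale.
exfalso.
have lead_uv : lead_coef u * lead_coef v = 1.
  by rewrite -lead_coefM -fuv; apply/monicP.
(* The leading coefficients of u and v are units, so reduction keeps sizes. *)
have size_red w x : lead_coef w * lead_coef x = 1 ->
    size (reduction p w) = size w.
  move=> wx1; rewrite size_map_poly_id0 //; apply/eqP => w0.
  have := congr1 (intr : int -> 'F_p) wx1.
  by rewrite rmorphM /= w0 mul0r rmorph1 => /esym/eqP; rewrite oner_eq0.
have phi_dvd w : w %| reduction p f -> size w != 1%N -> reduction p phi %| w.
  by rewrite fN; apply: irreducible_dvd_of_dvd_exp.
have redf : reduction p f = reduction p u * reduction p v.
  by rewrite fuv rmorphM.
have [|b [c uE]] := @dvdp_reductionP p phi u p_pr.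
  by apply: phi_dvd; rewrite ?redf ?dvdp_mulIl // (size_red _ v).
have [|b' [c' vE]] := @dvdp_reductionP p phi v p_pr.
  by apply: phi_dvd; rewrite ?redf ?dvdp_mulIr // (size_red _ u) // mulrC.
apply: (fnot (b * v + (c *+ p) * b') (c * c')).
rewrite fuv {1}uE vE; ring.
Qed.

(** * The critical orbit as a polynomial in the parameter *)

Definition crit_orbit (S : pzSemiRingType) (D : nat) (a : S) (n : nat) : S :=
  iter n (unicritical D a) 0.
Arguments crit_orbit : simpl never.

Lemma crit_orbitS (S : pzSemiRingType) D (a : S) n :
  crit_orbit D a n.+1 = a * crit_orbit D a n ^+ D + 1.
Proof. by []. Qed.

Lemma crit_orbitD (S : pzSemiRingType) D (a : S) m n :
  crit_orbit D a (m + n) = iter m (unicritical D a) (crit_orbit D a n).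
Proof. exact: iterD. Qed.

Lemma rmorph_crit_orbit (S T : pzSemiRingType) (f : {rmorphism S -> T}) D a n :
  f (crit_orbit D a n) = crit_orbit D (f a) n.
Proof.
by elim: n => [|n IHn]; rewrite ?rmorph0 // !crit_orbitS rmorphD rmorphM rmorphXn
  IHn rmorph1.
Qed.

Lemma map_crit_orbitX (S T : nzRingType) (f : {rmorphism S -> T}) D n :
  map_poly f (crit_orbit D 'X n) = crit_orbit D 'X n.
Proof. by rewrite rmorph_crit_orbit /= map_polyX. Qed.

Notation crit_poly S D n := (crit_orbit D ('X : {poly S}) n).

Lemma crit_orbitX_monic_size (S : idomainType) D n : (0 < D)%N ->
  crit_poly S D n.+1 \is monic /\
  (size (crit_poly S D n) < size (crit_poly S D n.+1))%N.
Proof.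
move=> D_gt0; elim: n => [|n [mon lt_size]].
  rewrite crit_orbitS expr0n eqn0Ngt D_gt0 mulr0 add0r.
  by rewrite monic1 size_poly1 size_poly0.
have mon' : crit_poly S D n.+1 ^+ D \is monic by apply: monic_exp.
set p := crit_poly S D n.+1 in mon mon' lt_size *.
have sizeX : size ('X * p ^+ D) = ((size p).-1 * D).+2.
  rewrite size_monicM ?monicX ?monic_neq0 // size_polyX -size_exp.
  by rewrite prednK // size_poly_gt0 monic_neq0.
have size1 : (size (1 : {poly S})%R < size ('X * p ^+ D)%R)%N.
  by rewrite size_poly1 sizeX.
rewrite (crit_orbitS D 'X n.+1) -/p (size_polyDl size1) sizeX; split.
  by rewrite monicE lead_coefDl // -monicE monicMl ?monicX.
by case: (size p) lt_size => // m _; rewrite /= ltnS ltnS leq_pmulr.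
Qed.

Lemma crit_orbitX_monic (S : idomainType) D n : (0 < D)%N -> (0 < n)%N ->
  crit_poly S D n \is monic.
Proof. by case: n => // n D_gt0 _; have [] := crit_orbitX_monic_size S n D_gt0. Qed.

Lemma crit_orbitX_size (S : idomainType) D m n : (0 < D)%N -> (m < n)%N ->
  (size (crit_poly S D m) < size (crit_poly S D n))%N.
Proof.
move=> D_gt0; elim: n => // n IHn; rewrite ltnS leq_eqVlt.
have [_ lt_size] := crit_orbitX_monic_size S n D_gt0.
by case/predU1P => [-> //|/IHn/ltn_trans]; apply.
Qed.

(** In characteristic 2 with D a power of 2, the difference of two orbit points
    evolves by z |-> a z^D. The exponent of [a] depends on l only, which makes
    the power of X cancel when period n is compared with period 1. *)
Lemma crit_orbit_pchar2 (S : comNzRingType) s (a : S) l : 2%N \in [pchar S] ->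
  exists M, forall n,
    crit_orbit (2 ^ s) a (l + n) + crit_orbit (2 ^ s) a l =
    a ^+ M * crit_orbit (2 ^ s) a n ^+ ((2 ^ s) ^ l).
Proof.
move=> char2; elim: l => [|l [M IHl]].
  by exists 0%N => n; rewrite [crit_orbit _ _ 0]/crit_orbit addr0 expr0 mul1r.
exists (M * 2 ^ s).+1 => n; rewrite addSn !crit_orbitS addrACA (addrr_pchar2 char2) addr0.
rewrite -mulrDr -(exprDn_pchar _ _ (n := 2 ^ s)) ?IHl; last first.
  by rewrite pnatX pnatE // char2.
by rewrite exprMn -!exprM exprS mulrA -expnSr.
Qed.

Section Divisibility.
Variables (S : idomainType) (D : nat) (a : {poly S}).

Lemma dvdp_iter_unicritical (x y : {poly S}) i :
  x - y %| iter i (unicritical D a) x - iter i (unicritical D a) y.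
Proof.
elim: i => // i /dvdp_trans; apply; rewrite !iterS /unicritical.
by rewrite opprD addrACA subrr addr0 -mulrBr dvdp_mull // subrXX dvdp_mulIl.
Qed.

Lemma dvdp_crit_orbit_shift n m :
  crit_orbit D a n %| crit_orbit D a (m + n) - crit_orbit D a m.
Proof.
by rewrite crit_orbitD -[X in X %| _]subr0; apply: dvdp_iter_unicritical.
Qed.

Lemma dvdp_crit_orbit_mul n t : crit_orbit D a n %| crit_orbit D a (t * n).
Proof.
elim: t => [|t IHt]; first by rewrite mul0n dvdp0.
rewrite mulSn addnC -[X in _ %| X](subrK (crit_orbit D a (t * n))).
by rewrite dvdp_add // dvdp_crit_orbit_shift.
Qed.

(** The points P_n and P_0 = 0 differ by P_n; a single step already turns this
    difference into a multiple of its D-th power, because the map depends on its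
    argument through the D-th power only. *)
Lemma dvdp_crit_orbit_shift_exp n m : (0 < m)%N ->
  crit_orbit D a n ^+ D %| crit_orbit D a (m + n) - crit_orbit D a m.
Proof.
case: m => // m _; rewrite crit_orbitD /crit_orbit !iterSr -/(crit_orbit D a n).
apply: dvdp_trans (dvdp_iter_unicritical _ _ _).
rewrite /unicritical opprD addrACA subrr addr0 -mulrBr dvdp_mull //.
case: (posnP D) => [->|D_gt0]; first by rewrite expr0 dvd1p.
by rewrite [0 ^+ D]expr0n eqn0Ngt D_gt0 subr0.
Qed.
End Divisibility.

Lemma dvdp_sum_exp2_sub (S : idomainType) (x y : {poly S}) i t : (i < t)%N ->
  x ^+ (2 ^ i) + y ^+ (2 ^ i) %| x ^+ (2 ^ t) - y ^+ (2 ^ t).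
Proof.
elim: t => // t IHt; rewrite ltnS expnSr !exprM subr_sqr leq_eqVlt.
case/predU1P => [->|/IHt it_dvd]; first by rewrite dvdp_mulIr.
by rewrite dvdp_mulr.
Qed.

(** * The irreducible factor carrying the Misiurewicz parameters *)

Section MisiurewiczFactor.

Variables (s j n l : nat).
Hypotheses (j_lt_s : (j < s)%N) (n_pr : prime n) (l_gt0 : (0 < l)%N).

Local Notation D := (2 ^ s)%N.
Local Notation e := (2 ^ j)%N.
Local Notation P m := (crit_poly int D m).
Local Notation phi := (crit_poly 'F_2 D n).

Hypothesis phi_irr : irreducible_poly phi.

Let D_gt0 : (0 < D)%N. Proof. by rewrite expn_gt0. Qed.
Let e_gt0 : (0 < e)%N. Proof. by rewrite expn_gt0. Qed.
Let n_gt0 : (0 < n)%N. Proof. exact: prime_gt0. Qed.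
Let D_gt1 : (1 < D)%N.
Proof. by rewrite -[1%N](expn0 2) ltn_exp2l // (leq_trans _ j_lt_s). Qed.

(** Modulo A the D-th powers of P_{l+1} and P_l agree, so P_{l+2} = P_{l+1} and
    the orbit is constant from then on. *)
Lemma fixed_factor_dvd m :
  P l.+1 ^+ e + P l ^+ e %| P (l + m.+1) ^+ e + P l ^+ e.
Proof.
set A := _ + _.
have AP : A %| P (l + m.+1) - P l.+1.
  elim: m => [|m IHm]; first by rewrite addn1 subrr dvdp0.
  have -> : P (l + m.+2) - P l.+1 = (P (l + m.+2) - P l.+2) + (P l.+2 - P l.+1).
    by rewrite addrA subrK.
  rewrite dvdp_add //; first by rewrite addnS (dvdp_trans IHm) // (dvdp_iter_unicritical _ _ _ _ 1).
  rewrite (crit_orbitS _ _ l.+1) (crit_orbitS _ _ l) opprD addrACA subrr addr0.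
  by rewrite -mulrBr dvdp_mull // dvdp_sum_exp2_sub.
have -> : P (l + m.+1) ^+ e + P l ^+ e = (P (l + m.+1) ^+ e - P l.+1 ^+ e) + A.
  by rewrite addrA subrK.
by rewrite dvdp_add // subrXX dvdp_mulr.
Qed.

Lemma sum_exp_monic m : P (l + m.+1) ^+ e + P l ^+ e \is monic.
Proof.
have mon i : (0 < i)%N -> P i ^+ e \is monic.
  by move=> i_gt0; apply/monic_exp/crit_orbitX_monic.
have lt_size : (size (P l ^+ e)%R < size (P (l + m.+1) ^+ e)%R)%N.
  rewrite -(prednK (n := size (P l ^+ e)%R)) ?size_poly_gt0 ?monic_neq0 ?mon //.
  rewrite -(prednK (n := size (P (l + m.+1) ^+ e)%R)) ?size_poly_gt0 ?monic_neq0 ?mon ?addnS //.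
  rewrite ltnS !size_exp ltn_pmul2r //.
  have : (size (P l) < size (P (l + m).+1))%N by apply: crit_orbitX_size => //; lia.
  have : (0 < size (P l))%N by rewrite size_poly_gt0 monic_neq0 // crit_orbitX_monic.
  by case: (size (P l)) => // q _; case: (size _).
by rewrite monicE lead_coefDl // -monicE mon // addnS.
Qed.

(** Modulo P_n the point P_l equals P_r with r the remainder of l by n, and for
    r > 0 this is a nonzero polynomial of smaller degree. *)
Lemma phi_ndvd_orbit : ~~ (n %| l)%N -> ~~ (phi %| crit_poly 'F_2 D l ^+ e).
Proof.
move=> n_ndvd; apply/negP => dvd_exp.
have {dvd_exp} : phi %| crit_poly 'F_2 D l.
  apply: contraLR dvd_exp; rewrite -!irreducible_poly_coprime //.
  exact: coprimep_expr.
pose r := (l %% n)%N; rewrite -(subrK (crit_poly 'F_2 D r) (crit_poly 'F_2 D l)).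
rewrite dvdp_addr; last first.
  rewrite [l in crit_poly _ _ l - _](divn_eq l n) addnC.
  by apply: dvdp_trans (dvdp_crit_orbit_shift _ _ _ _); apply: dvdp_crit_orbit_mul.
move/dvdp_leq => H; have := crit_orbitX_size 'F_2 D_gt0 (ltn_pmod l n_gt0).
rewrite ltnNge H // monic_neq0 // crit_orbitX_monic //.
by rewrite lt0n; apply: contra n_ndvd.
Qed.

Lemma sqr_dvd_orbit t : P n ^+ 2 %| P (t.+1 * n) - P n.
Proof.
rewrite mulSn; apply: dvdp_trans (dvdp_crit_orbit_shift_exp _ _ _ n_gt0).
apply: dvdp_trans (dvdp_exp2l _ D_gt1) _.
by rewrite dvdp_exp2r // dvdp_crit_orbit_mul.
Qed.

(** The last two clauses are what keeps f out of the ideal (P_n, 4): otherwise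
    that ideal would contain 2 u, and P_n would divide u modulo 2. The bound on c
    makes f at least the square of P_n modulo 2, hence of larger degree than
    P_n. *)
Lemma misiurewicz_factor : exists f c u w,
  [/\ P (l + n) ^+ e + P l ^+ e = f * (P l.+1 ^+ e + P l ^+ e) * P n ^+ c,
      (c + 2 <= e * D ^ l)%N,
      f * (P l.+1 ^+ e + P l ^+ e) = u *+ 2 + P n * w &
      ~~ (phi %| reduction 2 u)].
Proof.
have Pn_mon : P n \is monic by apply: crit_orbitX_monic.
have A_mon : P l.+1 ^+ e + P l ^+ e \is monic by have := sum_exp_monic 0; rewrite addn1.
have A_dvd := fixed_factor_dvd n.-1; rewrite (prednK n_gt0) in A_dvd.
have Dl : (2 <= D ^ l)%N by rewrite (leq_trans D_gt1) // -{1}(expn1 D) leq_exp2l.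
have [/dvdnP [t lE]|n_ndvd] := boolP (n %| l)%N; last first.
  have [f fE] := Pdiv.IdomainMonic.dvdpP A_mon _ A_dvd.
  have /(Pdiv.IdomainMonic.dvdpP Pn_mon) [w wE] :
      P n %| P (l + n) ^+ e - P l ^+ e.
    by rewrite subrXX dvdp_mulr // dvdp_crit_orbit_shift.
  exists f, 0%N, (P l ^+ e), w; split.
  - by rewrite expr0 mulr1.
  - by rewrite add0n (leq_trans Dl) // leq_pmull.
  - rewrite -fE [P n * w]mulrC -wE; ring.
  - by rewrite rmorphXn /= map_crit_orbitX phi_ndvd_orbit.
have t_gt0 : (0 < t)%N by case: (t) lE l_gt0 => // ->.
(* P_n^2 divides P_{(i+1)n} - P_n, so the quotient by P_n is 1 modulo P_n. *)
have cofactor i : exists2 x, P (i.+1 * n) = x * P n & P n %| x - 1.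
  have /(Pdiv.IdomainMonic.dvdpP Pn_mon) [x xE] :
      P n %| P (i.+1 * n) by apply: dvdp_crit_orbit_mul.
  exists x => //; rewrite -(dvdp_mul2r _ _ (monic_neq0 Pn_mon)) -expr2.
  by rewrite mulrBl mul1r -xE sqr_dvd_orbit.
have [y yE y1] := cofactor t.-1; rewrite prednK // -lE in yE.
have [x xE x1] := cofactor t; rewrite mulSn -lE addnC in xE.
have FE : P (l + n) ^+ e + P l ^+ e = (x ^+ e + y ^+ e) * P n ^+ e.
  by rewrite xE yE !exprMn mulrDl.
(* Modulo P_n, P_l vanishes and P_{l+1} is 1, so A is 1. *)
have cop : coprimep (P l.+1 ^+ e + P l ^+ e) (P n ^+ e).
  have /(Pdiv.IdomainMonic.dvdpP Pn_mon) [h hE] :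
      P n %| P l.+1 ^+ e + P l ^+ e - 1.
    rewrite addrAC dvdp_add //; last first.
      by rewrite dvdp_exp // yE dvdp_mulIr.
    rewrite -[X in _ - X](expr1n _ e) subrXX dvdp_mulr //.
    by rewrite crit_orbitS addrK dvdp_mull // dvdp_exp // yE dvdp_mulIr.
  apply: coprimep_expr; rewrite -(subrK 1 (_ + _)) hE.
  by rewrite coprimep_sym coprimep_addl_mul coprimep1.
have /(Pdiv.IdomainMonic.dvdpP A_mon) [f fE] :
    P l.+1 ^+ e + P l ^+ e %| x ^+ e + y ^+ e.
  by rewrite -(Gauss_dvdpl _ cop) -FE.
have pow1 z : P n %| z - 1 -> P n %| z ^+ e - 1.
  by move=> z1; rewrite -[X in _ - X](expr1n _ e) subrXX dvdp_mulr.
have /(Pdiv.IdomainMonic.dvdpP Pn_mon) [w wE] :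
    P n %| (x ^+ e - 1) + (y ^+ e - 1).
  by rewrite dvdp_add // pow1.
exists f, e, 1, w; split.
- by rewrite FE fE.
- have l_gt1 : (1 < l)%N.
    by rewrite lE (leq_trans (prime_gt1 n_pr)) // leq_pmull.
  have : (2 ^ 2 <= D ^ l)%N.
    by rewrite (leq_trans (n := D ^ 2)%N) ?leq_exp2r // leq_exp2l.
  nia.
- rewrite -fE [P n * w]mulrC -wE; ring.
- by rewrite rmorph1 dvdp1; case: phi_irr => + _; case: size => [|[]].
Qed.

(** The non-divisibilities serve to separate the zeros of f from those of the two
    factors removed from the equation. Modulo 2 the period-1 factor is a power of
    X, which is prime to P_n because P_n takes the value 1 at 0. *)
Lemma misiurewicz_irreducible_factor : exists f c,
  [/\ P (l + n) ^+ e + P l ^+ e = f * (P l.+1 ^+ e + P l ^+ e) * P n ^+ c,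
      f \is monic, irreducible_poly f,
      ~~ (f %| P l.+1 ^+ e + P l ^+ e) & ~~ (f %| P n)].
Proof.
have [f [c [u [w [FE c_le uwE u_ndvd]]]]] := misiurewicz_factor.
have Pn_mon : P n \is monic by apply: crit_orbitX_monic.
have A_mon : P l.+1 ^+ e + P l ^+ e \is monic by have := sum_exp_monic 0; rewrite addn1.
have F_mon := sum_exp_monic n.-1; rewrite (prednK n_gt0) FE in F_mon.
rewrite monicMr ?monic_exp // monicMr // in F_mon.
have char2 : 2%N \in [pchar {poly 'F_2}] by rewrite pchar_poly pchar_Fp.
have [M ME] := @crit_orbit_pchar2 {poly 'F_2} s 'X l char2.
have phi0 : phi != 0 by rewrite monic_neq0 // crit_orbitX_monic.
have sumE m : reduction 2 (P (l + m) ^+ e + P l ^+ e) =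
    'X ^+ (M * e) * crit_poly 'F_2 D m ^+ (D ^ l * e).
  rewrite rmorphD !rmorphXn /= !map_crit_orbitX -exprDn_pchar.
    by rewrite ME exprMn -!exprM.
  by rewrite pnatX pnatE // char2.
have AE : reduction 2 (P l.+1 ^+ e + P l ^+ e) = 'X ^+ (M * e).
  have := sumE 1%N; rewrite addn1 => ->; rewrite crit_orbitS expr0n.
  by rewrite eqn0Ngt D_gt0 mulr0 add0r expr1n mulr1.
have redf : reduction 2 f = phi ^+ (D ^ l * e - c).
  have X0 : 'X ^+ (M * e) != 0 :> {poly 'F_2} by rewrite monic_neq0 // monicXn.
  apply: (mulIf (expf_neq0 c phi0)); apply: (mulIf X0).
  rewrite -exprD subnK; last lia.
  rewrite mulrC [RHS]mulrC -sumE FE !rmorphM /= AE.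
  by rewrite rmorphXn /= map_crit_orbitX mulrCA mulrA.
have N_ge2 : (2 <= D ^ l * e - c)%N by lia.
exists f, c; split => //.
- apply: (@schonemann_criterion 2 (D ^ l * e - c) f (P n)); rewrite ?map_crit_orbitX //; first lia.
  move=> q r fE.
  (* Comparing the two expressions of f A gives an identity in 2 Z[X]. As P_n is
     monic, the cofactor of P_n is itself even, and halving the identity makes
     P_n divide u modulo 2. *)
  have hE : P n * (q * (P l.+1 ^+ e + P l ^+ e) - w) =
      (u - (r * (P l.+1 ^+ e + P l ^+ e)) *+ 2) *+ 2.
    rewrite mulrBr mulrA [X in _ - X](_ : _ = f * (P l.+1 ^+ e + P l ^+ e) - u *+ 2).
      by rewrite fE; ring.
    by rewrite uwE; ring.
  have [|h hE'] := @reduction_eq0P 2 (q * (P l.+1 ^+ e + P l ^+ e) - w) isT.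
    apply: (mulfI phi0); rewrite -(map_crit_orbitX (intr : {rmorphism int -> 'F_2})).
    rewrite -rmorphM hE mulr0 rmorphMn /= -mulr_natr.
    by rewrite (pcharf0 char2) mulr0.
  have uE : P n * h = u - (r * (P l.+1 ^+ e + P l ^+ e)) *+ 2.
    move: hE; rewrite hE' mulrnAr => /polyP hE.
    by apply/polyP => i; have := hE i; rewrite !coefMn => /(@Num.Theory.pmulrnI int 2 isT).
  move/negP: u_ndvd; apply.
  rewrite -(subrK ((r * (P l.+1 ^+ e + P l ^+ e)) *+ 2) u) -uE rmorphD.
  rewrite rmorphM /= map_crit_orbitX rmorphMn /= -mulr_natr (pcharf0 char2) mulr0 addr0.
  exact: dvdp_mulIl.
- apply/negP => /(Pdiv.IdomainMonic.dvdpP F_mon) [q qE].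
  have : phi %| 'X ^+ (M * e).
    by rewrite -AE qE rmorphM /= redf dvdp_mull // dvdp_exp //; lia.
  apply/negP; rewrite -irreducible_poly_coprime // coprimep_expr //.
  rewrite coprimepX /root -[n]prednK // crit_orbitS.
  by rewrite hornerD hornerM hornerX mul0r add0r hornerC oner_eq0.
- apply/negP => /(dvdp_leq (monic_neq0 Pn_mon)).
  rewrite -(size_reduction_monic 2 F_mon) -(size_reduction_monic 2 Pn_mon) redf map_crit_orbitX.
  have [phi_gt1 _] := phi_irr; have := size_exp phi (D ^ l * e - c).
  move: N_ge2 phi_gt1; move: (_ - _)%N (size _) (size _) => N a b N2 a1 ba.
  nia.
Qed.

End MisiurewiczFactor.

(** * Misiurewicz parameters as zeros of polynomials *)

Section PrimePeriod.
Variables (T : eqType) (g : T -> T).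

Lemma iter_mul_fix m q z : iter m g z = z -> iter (q * m) g z = z.
Proof. by move=> zm; elim: q => // q IHq; rewrite mulSn iterD IHq. Qed.

(** If z also returned after m < n steps, Bezout's relation between m and n would
    fix it after a single step. *)
Lemma has_prime_period n z :
  prime n -> iter n g z = z -> g z <> z -> has_period g z n.
Proof.
move=> n_pr zn gz; split; rewrite ?prime_gt0 // => m /andP [m_gt0 m_lt] zm.
have [km kn kmn _] := egcdnP n m_gt0; apply: gz.
have cop : coprime m n by rewrite coprime_sym prime_coprime // gtnNdvd.
have := iter_mul_fix km zm; rewrite kmn (eqP cop) addnC iterD.
by rewrite iter_mul_fix.
Qed.

Lemma iter_fix_periodic m z : (0 < m)%N -> iter m g z = z -> periodic g z.
Proof.
move=> m_gt0 zm; have exm : exists m, (0 < m)%N && (iter m g z == z).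
  by exists m; rewrite m_gt0 zm /=.
case: (ex_minnP exm) => k /andP [k_gt0 /eqP zk] k_min; exists k; split=> // i.
case/andP=> i_gt0; rewrite ltnNge => /negP ik zi; apply: ik.
by apply: k_min; rewrite i_gt0 zi /=.
Qed.

(** On a cycle the map can be inverted by going around, so a return of the image
    is a return of the point. *)
Lemma periodic_return n z : periodic g z -> iter n g (g z) = g z -> iter n g z = z.
Proof.
case=> [[|k]] [] // _ zk _ gzn.
by rewrite -zk iterSr -iterD addnC iterD gzn.
Qed.

Lemma periodic_iter m z : periodic g z -> periodic g (iter m g z).
Proof.
by case=> k [k_gt0 zk _]; apply: (iter_fix_periodic k_gt0); rewrite -iterD addnC iterD zk.
Qed.

End PrimePeriod.

Lemma eq_exp2_of_sum0 (S : comNzRingType) (x y : S) j s : (j < s)%N ->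
  x ^+ (2 ^ j) + y ^+ (2 ^ j) = 0 -> x ^+ (2 ^ s) = y ^+ (2 ^ s).
Proof.
move=> js /eqP; rewrite addr_eq0 => /eqP xy.
by rewrite -(subnKC js) expnD expnSr !exprM xy sqrrN.
Qed.

Lemma prim_root_exp2P (F : numFieldType) (w : F) j :
  (2 ^ j.+1).-primitive_root w <-> w ^+ (2 ^ j) = -1.
Proof.
split=> [w_prim | wN1].
  have : (w ^+ (2 ^ j)) ^+ 2 == 1 by rewrite -exprM -expnSr prim_expr_order.
  rewrite sqrf_eq1 => /orP [|/eqP //].
  by rewrite -(prim_order_dvd w_prim) dvdn_Pexp2l // ltnn.
have [||m w_prim] := @prim_order_exists _ (2 ^ j.+1) w.
- by rewrite expn_gt0.
- by rewrite expnSr exprM wN1 sqrrN expr1n.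
case/(dvdn_pfactor _ _ (isT : prime 2)) => i i_le mE; move: w_prim; rewrite mE.
move: i_le; rewrite leq_eqVlt => /predU1P [-> //|i_lt] w_prim.
have : w ^+ (2 ^ j) == 1 by rewrite -(prim_order_dvd w_prim) dvdn_exp2l.
by rewrite wN1 eq_sym -addr_eq0 (Num.Theory.pnatr_eq0 F 2).
Qed.

(** If P_l were 0, the equation would give P_{l+n} = 0, which is P_n because the
    orbit restarts at 0. So the equation says that P_{l+n} = w P_l for a
    primitive w; both points then have the same image, which is fixed by the n-th
    iterate. The second condition excludes that the cycle reached is a fixed
    point. The points before it are not periodic: otherwise P_{l+n} = P_l, and
    2 P_l^e = 0. *)
Lemma misiurewiczP (C : numFieldType) (s j n l : nat) (a : C) :
    (j < s)%N -> prime n ->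
  let P := crit_orbit (2 ^ s) a in
  misiurewicz (2 ^ s) l.+1 n (2 ^ j.+1) a <->
  [/\ P (l + n)%N ^+ (2 ^ j) + P l ^+ (2 ^ j) = 0,
      P l.+1 ^+ (2 ^ j) + P l ^+ (2 ^ j) <> 0 & P n <> 0].
Proof.
move=> js n_pr P; set D := (2 ^ s)%N; set e := (2 ^ j)%N.
have n_gt0 := prime_gt0 n_pr; have e_gt0 : (0 < e)%N by rewrite expn_gt0.
pose g := unicritical D a.
have PD i m : iter i g (P m) = P (i + m)%N by rewrite /P crit_orbitD.
have PS_eq m m' : P m ^+ e + P m' ^+ e = 0 -> P m.+1 = P m'.+1.
  by move=> mm'; rewrite /P !crit_orbitS (eq_exp2_of_sum0 js mm').
rewrite /misiurewicz /preperiodic /= addSn !subn1 /=.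
rewrite -/(crit_orbit D a (l + n)) -/(crit_orbit D a l) -/P -/g.
rewrite -/(iter l.+1 g 0) -/(crit_orbit D a l.+1) -/P.
split=> [[[[_ _ per] nper] [w w_prim Pw]] | [F0 A0 Pn0]].
  have we := (prim_root_exp2P w j).1 w_prim; split.
  - by rewrite Pw exprMn we mulN1r addNr.
  - move=> A0; apply: (per 1%N); first by rewrite prime_gt1.
    exact: (PS_eq l.+1 l A0).
  - by move=> Pn0; apply: (nper 0%N) => //; apply: iter_fix_periodic n_gt0 _.
have Pl0 : P l != 0.
  apply/eqP => Pl0; apply: Pn0; have := F0; rewrite Pl0 expr0n eqn0Ngt e_gt0 addr0.
  by move=> /eqP; rewrite expf_eq0 e_gt0 addnC -PD Pl0 => /eqP.
have cycle : P (l + n).+1 = P l.+1 by apply: PS_eq.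
split; last first.
  exists (P (l + n)%N / P l); last by rewrite divfK.
  apply/prim_root_exp2P; rewrite expr_div_n; apply/eqP.
  rewrite -subr_eq0 opprK -[X in _ + X](divff (expf_neq0 e Pl0)) -mulrDl F0.
  by rewrite mul0r.
split; first apply: has_prime_period => //.
- by rewrite PD addnS addnC.
- move=> fixed; apply: A0; rewrite -[in RHS]F0 -(prednK n_gt0) addnS -addSn addnC -PD.
  by rewrite iter_fix.
move=> i; rewrite ltnS => il per_i.
have per_l : periodic g (P l).
  by rewrite -(subnK il) -PD; apply: periodic_iter.
have : P (l + n)%N = P l.
  rewrite addnC -PD; apply: periodic_return => //.
  have -> : g (P l) = P l.+1 by [].
  by rewrite PD addnS addnC.
move=> Pln; move/eqP: F0; rewrite Pln -mulr2n -mulr_natr mulf_eq0 expf_eq0 (negPf Pl0).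
by rewrite andbF Num.Theory.pnatr_eq0.
Qed.

(** * Irreducibility of X^9 + X + 1 over F_2 *)

(** A root z of a divisor of degree at most 4 has degree at most 4 over F_2, hence
    z^8 = z (degree 3) or z^16 = z (degree 1, 2 or 4). Neither is compatible with
    z^9 = z + 1: the first makes z a cube root of unity with z^2 = z, the second
    leads to z = -1. *)
Lemma no_small_factor_trinomial (d : {poly 'F_2}) :
  (1 < size d <= 5)%N -> ~~ (d %| 'X^9 + 'X + 1).
Proof.
case/andP=> d_gt1 d_le5; apply/negP => d_dvd.
have d0 : d != 0 by rewrite -size_poly_gt0 ltnW.
have [L [rs d_rs _]] := FinSplittingFieldFor d0.
have two : 2%N \in [pchar L] by rewrite pchar_lalg pchar_Fp.
have rs_size : (size rs).+1 = size d.
  by rewrite -(size_prod_XsubC rs id) -(eqp_size d_rs) size_map_poly.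
case: rs d_rs rs_size d_gt1 => [|z rs] d_rs rs_size; first by rewrite -rs_size.
move=> _; have dz : root (map_poly (GRing.in_alg L) d) z.
  by rewrite (eqp_root d_rs) root_prod_XsubC mem_head.
have z9 : z ^+ 9 = - z - 1.
  have : root (map_poly (GRing.in_alg L) ('X^9 + 'X + 1)) z.
    by apply: root_dvdp dz; rewrite dvdp_map.
  rewrite !rmorphD rmorph1 /= map_polyXn map_polyX /root !hornerE.
  by rewrite -addrA addr_eq0 opprD => /eqP.
have deg : (0 < \dim <<1; z>> <= 4)%N.
  rewrite adim_gt0 dim_Fadjoin dimv1 muln1 -ltnS -size_minPoly.
  apply: leq_trans d_le5; rewrite -(size_map_poly (GRing.in_alg L) d).
  apply: dvdp_leq; first by rewrite map_poly_eq0.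
  by apply: minPoly_dvdp => //; apply: alg_polyOver.
have := Fermat's_little_theorem <<1; z>>%AS z; rewrite memv_adjoin card_Fp // => /esym/eqP zq.
have zz : z + z = 0 := addrr_pchar2 two z.
have z0 : z != 0.
  apply/eqP => z0; move/eqP: z9; rewrite z0 expr0n oppr0 sub0r eq_sym oppr_eq0.
  by rewrite oner_eq0.
suff [z8|z16] : z ^+ 8 = z \/ z ^+ 16 = z.
- have z2 : z ^+ 2 = - z - 1 by rewrite -z9 [RHS]exprS z8 expr2.
  have z3 : z ^+ 3 = 1 by rewrite exprS z2 mulrBr mulrN -expr2 z2; ring.
  have z2z : z ^+ 2 = z.
    by rewrite -[RHS]z8 (exprD z 6 2) (exprM z 3 2) z3 expr1n mul1r.
  have : (1 : L) = 0 by rewrite -oppr0 -zz -{1}z2z z2; ring.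
  by apply/eqP/oner_neq0.
- have z7 : z ^+ 7 = - z ^+ 6 - 1.
    apply: (mulfI z0); rewrite mulrBr mulr1 mulrN -!exprS -[X in _ - X]z16.
    by rewrite (exprD z 9 7) z9; ring.
  have z6 : z ^+ 6 = - z ^+ 2.
    have z9' : z ^+ 9 = - z ^+ 6 - 1 + z - z ^+ 2.
      have -> : z ^+ 9 = - (z * z ^+ 7) - z ^+ 2.
        by rewrite [z ^+ 9](exprD z 2 7) {1}z7; ring.
      by rewrite z7 mulrBr mulr1 mulrN -exprS z7; ring.
    have -> : z ^+ 6 = z + z - z ^+ 2 - (z ^+ 9 - (- z - 1)) by rewrite z9'; ring.
    by rewrite zz z9 subrr subr0 sub0r.
  have z4 : z ^+ 4 = -1.
    by apply: (mulfI (expf_neq0 2 z0)); rewrite -exprD mulrN1.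
  have z3 : z ^+ 3 = 1 - z ^+ 2.
    have -> : z ^+ 3 = - z ^+ 7 by rewrite (exprD z 3 4) z4; ring.
    by rewrite z7 z6; ring.
  have z2 : z ^+ 2 = - z.
    have -> : z ^+ 2 = z ^+ 4 - z + 1.
      by rewrite [z ^+ 4]exprS z3 mulrBr mulr1 -exprS z3; ring.
    by rewrite z4; ring.
  have z1 : z = -1 by apply: (mulfI z0); rewrite mulrN1 -z2 expr2.
  have : (1 : L) = 0.
    have -> : (1 : L) = - (-1) ^+ 3 by ring.
    by rewrite -z1 z3 z1; ring.
  by apply/eqP/oner_neq0.
case: (\dim _) deg zq => [|[|[|[|[|m]]]]] //= _ zq; [right|right|left|right].
- have {}zq : z ^+ 2 = z by [].
  by rewrite (exprM z 2 8) zq (exprM z 2 4) zq (exprM z 2 2) zq.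
- have {}zq : z ^+ 4 = z by [].
  by rewrite (exprM z 4 4) zq.
- exact: zq.
- exact: zq.
Qed.

Lemma crit_poly_8_3_irreducible : irreducible_poly (crit_poly 'F_2 8 3).
Proof.
have two : 2%N \in [pchar {poly 'F_2}] by rewrite pchar_poly pchar_Fp.
have fE : crit_poly 'F_2 8 3 = 'X^9 + 'X + 1.
  rewrite !crit_orbitS expr0n mulr0 add0r expr1n mulr1.
  have pow8 : [pchar {poly 'F_2}].-nat (2 ^ 3)%N by rewrite pnatX pnatE // two.
  rewrite (exprDn_pchar 'X 1 pow8) expr1n.
  by rewrite mulrDr mulr1 -exprS.
have size9 : size (crit_poly 'F_2 8 3) = 10.
  rewrite fE -addrA size_polyDl size_polyXn //.
  by rewrite (leq_ltn_trans (size_polyD _ _)) // size_polyX size_poly1.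
split; first by rewrite size9.
move=> q q1 q_dvd; have f0 : crit_poly 'F_2 8 3 != 0 by rewrite -size_poly_gt0 size9.
have [w wE] := Pdiv.Field.dvdpP _ _ q_dvd.
have [w0 q0] : w != 0 /\ q != 0.
  by apply/andP; rewrite -negb_or -mulf_eq0 -wE.
have size_wq : (size w + size q).-1 = 10 by rewrite -size_mul // -wE.
have {q0}q_gt1 : (1 < size q)%N by rewrite ltn_neqAle eq_sym q1 size_poly_gt0.
have [w1|w1] := eqVneq (size w) 1%N.
  by rewrite -dvdp_size_eqp // size9 -size_wq w1.
have {w0 w1}w_gt1 : (1 < size w)%N by rewrite ltn_neqAle eq_sym w1 size_poly_gt0.
have w_dvd : w %| crit_poly 'F_2 8 3 by rewrite wE dvdp_mulIl.
exfalso; have [q_le5|q_gt5] := leqP (size q) 5.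
  by have := @no_small_factor_trinomial q; rewrite -fE q_dvd q_gt1 q_le5 => /(_ isT).
(* The degrees of q and w add up to 9. *)
have w_le5 : (size w <= 5)%N.
  by move: size_wq q_gt5 {w_dvd}; move: (size w) (size q) => x y; lia.
by have := @no_small_factor_trinomial w; rewrite -fE w_dvd w_gt1 w_le5 => /(_ isT).
Qed.

(** * The product over the Misiurewicz parameters *)

Lemma horner_crit_poly (S : comNzRingType) D (a : S) m :
  (crit_poly S D m).[a] = crit_orbit D a m.
Proof.
elim: m => [|m IHm]; first exact: horner0.
by rewrite !crit_orbitS hornerD hornerM hornerX horner_exp hornerC IHm.
Qed.

Lemma irreducible_dvdp_of_root (C : numFieldType) (f g : {poly int}) (a : C) :
    irreducible_poly f -> root (map_poly intr f) a ->
    root (map_poly intr g) a ->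
  f %| g.
Proof.
move=> f_irr fa ga; apply: contraLR ga.
have ratrE (h : {poly int}) : map_poly ratr (map_poly (intr : int -> rat) h) =
    map_poly (intr : int -> C) h.
  by rewrite -map_poly_comp; apply: eq_map_poly => c /=; rewrite ratr_int.
rewrite -dvdp_rat_int -irreducible_poly_coprime; last exact/irreducible_rat_int.
rewrite -(coprimep_map (ratr : {rmorphism rat -> C})) !ratrE.
by move/coprimep_root => /(_ a fa).
Qed.

Lemma irreducible_separable (F : realFieldType) (f : {poly F}) :
  irreducible_poly f -> separable_poly f.
Proof.
move=> f_irr; have [f_gt1 _] := f_irr.
rewrite unlock irreducible_poly_coprime //.
rewrite gtNdvdp // -?size_poly_gt0 size_deriv; first by rewrite -subn1 subn_gt0.
by rewrite ltn_predL ltnW.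
Qed.

Lemma misiurewicz_product_irreducible (C : numClosedFieldType) (s j n l : nat) :
    (j < s)%N -> prime n -> (0 < l)%N ->
    irreducible_poly (crit_poly 'F_2 (2 ^ s) n) ->
  irreducible_over_rat
    (\big[*%R/1]_(a \in misiurewicz (2 ^ s) l.+1 n (2 ^ j.+1))
       ('X - (a : C)%:P)).
Proof.
move=> js n_pr l_gt0 phi_irr.
have [f [c [FE f_mon f_irr f_ndvdA f_ndvdP]]] :=
  misiurewicz_irreducible_factor js n_pr l_gt0 phi_irr.
pose fC : {poly C} := map_poly intr f.
have ratrE : map_poly ratr (map_poly (intr : int -> rat) f) = fC.
  by rewrite -map_poly_comp; apply: eq_map_poly => z /=; rewrite ratr_int.
exists (map_poly intr f); last exact/irreducible_rat_int.
rewrite ratrE; have [r fr] := closed_field_poly_normal fC.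
have fC_mon : fC \is monic by apply: monic_map.
rewrite (monicP fC_mon) scale1r in fr.
have r_uniq : uniq r.
  rewrite -separable_prod_XsubC -fr -ratrE separable_map.
  exact/irreducible_separable/irreducible_rat_int.
suff -> : misiurewicz (2 ^ s) l.+1 n (2 ^ j.+1) = [set` r]%classic.
  by rewrite -fsbig_seq.
rewrite predeqE => a /=; rewrite -root_prod_XsubC -fr.
have evalE m : (map_poly (intr : int -> C) (crit_poly int (2 ^ s) m)).[a] =
    crit_orbit (2 ^ s) a m.
  by rewrite map_crit_orbitX horner_crit_poly.
have := congr1 (fun g : {poly int} => (map_poly (intr : int -> C) g).[a]) FE.
rewrite /= !rmorphM !rmorphD !rmorphXn /= !hornerM !hornerD !horner_exp !evalE -/fC.
move=> FaE; apply: (iff_trans (misiurewiczP l a js n_pr)).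
rewrite FaE; split=> [[/eqP]|fa].
  by rewrite !mulf_eq0 expf_eq0 => /orP [/orP [//|/eqP A0 /(_ A0)]|/andP [_ /eqP P0] _ /(_ P0)].
have fa0 : fC.[a] = 0 by apply/eqP.
split; first by rewrite fa0 !mul0r.
- move=> A0; move/negP: f_ndvdA; apply; apply: (irreducible_dvdp_of_root f_irr fa).
  by rewrite /root !rmorphD !rmorphXn /= !hornerD !horner_exp !evalE A0.
- move=> P0; move/negP: f_ndvdP; apply; apply: (irreducible_dvdp_of_root f_irr fa).
  by rewrite /root evalE P0.
Qed.

Theorem corollary21 (R : realType) (k : nat) (hk : (2 <= k)%N) :
  [/\ irreducible_over_rat (misiurewicz_poly R 8 k 3 2),
      irreducible_over_rat (misiurewicz_poly R 8 k 3 4) &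
      irreducible_over_rat (misiurewicz_poly R 8 k 3 8)].
Proof.
case: k hk => [|l] // l_gt0.
have irr (j : nat) : (j < 3)%N ->
    irreducible_over_rat (misiurewicz_poly R (2 ^ 3) l.+1 3 (2 ^ j.+1)).
  by move=> j_lt; apply: misiurewicz_product_irreducible => //; apply: crit_poly_8_3_irreducible.
by split; [apply: (irr 0%N)|apply: (irr 1%N)|apply: (irr 2%N)].
Qed.
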